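(* Let $q\in\mathbb{C}$ with $0<|q|<1$, let $n$ and $m$ be positive integers, let $A\in\mathbb{C}^{N\times N}$ be a positive stable matrix and let $s\in\mathbb{C}$, $s\neq0$. Then $$L_{s,q}\big[J_{n,q}(t;A)\big]=\frac{(q^{A-I};q)_{n}}{s\,(q;q)_{n}}\;{}_{3}\Phi_{2}\left(q^{-nI},q^{A+(n-1)I},q;\mathbf{0},\mathbf{0};q,\frac{1}{s}\right)$$ and $$L_{s,q}\big[t^{m-1}J_{n,q}(t;A)\big]=\frac{(q;q)_{\infty}(q^{A-I};q)_{n}}{s^{m}(q;q)_{n}(q^{m};q)_{\infty}}\;{}_{3}\Phi_{2}\left(q^{-nI},q^{A+(n-1)I},q^{mI};\mathbf{0},\mathbf{0};q,\frac{1}{s}\right).$$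
   Context: Fix a value of $\log q$ and put $q^{M}=e^{M\log q}$ for a square complex matrix $M$; $I$ is the identity matrix and $\mathbf{0}$ the zero matrix. A matrix is positive stable if all its eigenvalues have positive real part. For a square matrix (or scalar) $M$, $(M;q)_0=I$, $(M;q)_k=\prod_{\tau=0}^{k-1}(I-q^{\tau}M)$ and $(M;q)_\infty=\prod_{\tau=0}^{\infty}(I-q^{\tau}M)$ (with $I$ replaced by $1$ for scalars); a scalar parameter $q$ is identified with $qI$. The $q$-Bessel matrix polynomials are $$J_{n,q}(z;A)=\frac{(q^{A-I};q)_{n}}{(q;q)_{n}}\sum_{k=0}^{\infty}\frac{(q^{-nI};q)_k(q^{A+(n-1)I};q)_k}{(q;q)_k}z^{k}$$ (a finite sum, since $(q^{-nI};q)_k=\mathbf{0}$ for $k>n$). For commuting matrices $P,Q,R$, $${}_{3}\Phi_{2}(P,Q,R;\mathbf{0},\mathbf{0};q,w)=\sum_{k=0}^{\infty}\frac{(P;q)_k(Q;q)_k(R;q)_k}{(q;q)_k}w^{k}$$ (since $(\mathbf{0};q)_k=I$). The $q$-Laplace transform of a function $f(t)$ is $$L_{s,q}[f(t)]=\frac{(q;q)_{\infty}}{s}\sum_{r=0}^{\infty}\frac{q^{r}}{(q;q)_{r}}f\!\left(\frac{q^{r}}{s}\right).$$ *)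

(* Defs.v *)
From HB Require Import structures.
From mathcomp Require Import all_boot all_order all_algebra.
From mathcomp Require Import complex.
From mathcomp Require Import all_classical all_reals all_analysis.

Set Implicit Arguments.
Unset Strict Implicit.
Unset Printing Implicit Defensive.

Import Order.TTheory GRing.Theory Num.Theory.
Import numFieldNormedType.Exports.

Local Open Scope ring_scope.
Local Open Scope complex_scope.
Local Open Scope classical_set_scope.

(* R[i] carries no topology of its own: give it the one defined by the complex
   modulus.  Matrices over R[i] then get the topology of entrywise
   convergence (sup norm). *)
HB.instance Definition _ (R : realType) := NormedModule.copy R[i] R[i]^o.

Section QCalculus.
Context {R : realType} {N : nat}.
Implicit Types (q a z w s logq : R[i]) (M P Q S A : 'M[R[i]]_N).

Definition cexp z : R[i] := limn (series (fun k => z ^+ k / k`!%:R)).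

Definition mexp M : 'M[R[i]]_N :=
  limn (series (fun k => (k`!%:R : R[i])^-1 *: M ^+ k)).

(* q ^ M = e ^ (M log q), for the chosen value logq of log q *)
Definition qpow logq M : 'M[R[i]]_N := mexp (logq *: M).

Definition positive_stable M : Prop :=
  forall a, eigenvalue M a -> 0 < complex.Re a.

Definition qpoch q a (k : nat) : R[i] := \prod_(t < k) (1 - q ^+ t * a).

Definition qpoch_inf q a : R[i] := limn (qpoch q a).

Definition mqpoch q M (k : nat) : 'M[R[i]]_N :=
  \prod_(t < k) (1%:M - q ^+ t *: M).

Definition qBessel q logq (n : nat) z A : 'M[R[i]]_N :=
  (qpoch q q n)^-1 *: mqpoch q (qpow logq (A - 1%:M)) n *m
  limn (series (fun k => (z ^+ k / qpoch q q k) *: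
    (mqpoch q (qpow logq (- n%:R)%:M) k *m
     mqpoch q (qpow logq (A + (n%:R - 1)%:M)) k))).

(* 3Phi2(P, Q, S; 0, 0; q, w): the factors (0; q)_k of the denominator are the
   identity matrix. *)
Definition phi32_00 P Q S q w : 'M[R[i]]_N :=
  limn (series (fun k => (w ^+ k / qpoch q q k) *:
    (mqpoch q P k *m mqpoch q Q k *m mqpoch q S k))).

(* limn has a junk value on divergent sequences; the partial sums are named so
   that their convergence can be asserted. *)
Definition qLaplace_series s q (f : R[i] -> 'M[R[i]]_N) : nat -> 'M[R[i]]_N :=
  series (fun r => (q ^+ r / qpoch q q r) *: f (q ^+ r / s)).

Definition qLaplace s q (f : R[i] -> 'M[R[i]]_N) : 'M[R[i]]_N :=
  (qpoch_inf q q / s) *: limn (qLaplace_series s q f).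

End QCalculus.

(* Main.v *)
(** Only the scalar matrices q^(-nI) = q^(-n) I and q^(mI) = q^m I have to be
    computed.  The first makes the q-Bessel sum finite, so the q-Laplace
    transform is a finite combination of the series
    T_j = sum_r q^((j+1)r) / (q;q)_r.  The partial sums of T_0 telescope to
    1 / (q;q)_n, and T_(j+1) = (1 - q^(j+1)) T_j, whence
    T_j = (q;q)_j / (q;q)_oo.  The addition formula for the exponential of R[i]
    follows from that of the real one: the remainder in the product of two
    partial sums is dominated by the same remainder at the moduli. *)

Require Import Defs.
From HB Require Import structures.
From mathcomp Require Import all_boot all_order all_algebra.
From mathcomp Require Import complex.
From mathcomp Require Import ring zify.
From mathcomp Require Import all_classical all_reals all_analysis.

Set Implicit Arguments.
Unset Strict Implicit.
Unset Printing Implicit Defensive.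

Import Order.TTheory GRing.Theory Num.Theory.
Import numFieldNormedType.Exports.

Local Open Scope ring_scope.
Local Open Scope complex_scope.
Local Open Scope classical_set_scope.

(** * Convergence of complex sequences and series *)

Lemma cvg_real_complex (R : realType) (u : nat -> R) (l : R) :
  u @ \oo --> l -> (fun n => (u n)%:C) @ \oo --> (l%:C : R[i]).
Proof.
move=> ul; apply/cvgrPdist_lt => e e0.
(* A positive element of [R[i]] is real, so its real part can serve as the tolerance for [u]. *)
have eE : e = (complex.Re e)%:C by rewrite RRe_real // gtr0_real.
have e0' : 0 < complex.Re e by rewrite eE ltcR in e0.
move/cvgrPdist_lt : ul => /(_ _ e0'); apply: filterS => n.
by rewrite -rmorphB /= eE /= ltcE /= eqxx /= expr0n addr0 sqrtr_sqr.
Qed.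

Lemma cvg_ReIm (R : realType) (u : nat -> R[i]) :
  cvgn (@complex.Re R \o u) -> cvgn (@complex.Im R \o u) -> cvgn u.
Proof.
move=> /cvg_real_complex cr /cvg_real_complex ci.
have H := cvgD (K := R[i]) cr (cvgM (K := R[i]) (cvg_cst ('i%C : R[i])) ci).
have -> : u = (fun n => ((@complex.Re R \o u) n)%:C) +
    ((fun=> 'i%C) \* (fun n => ((@complex.Im R \o u) n)%:C)) :> (nat -> R[i]).
  by apply/funext => n; rewrite [LHS]complexE.
by apply/cvg_ex; eexists; exact: H.
Qed.

Lemma norm_normc (R : rcfType) (z : R[i]) : `|z| = (Normc.normc z)%:C.
Proof. by []. Qed.

(** Real and imaginary parts are additive and bounded by the modulus, so each of the two real series
    converges absolutely by comparison with [v]. *)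
Lemma norm_series_cvg (R : realType) (u : nat -> R[i]) (v : nat -> R) :
  (forall n, Normc.normc (u n) <= v n) -> cvgn (series v) -> cvgn (series u).
Proof.
move=> uv cv.
have v0 n : 0 <= v n.
  by rewrite (le_trans _ (uv n)) // -ler0c -norm_normc.
have dom (f : R[i] -> R) : {morph f : x y / x + y} -> f 0 = 0 ->
    (forall z, `|f z| <= Normc.normc z) -> cvgn (f \o series u).
  move=> fD f0 fle.
  have -> : f \o series u = series (f \o u).
    by apply/funext => n /=; rewrite /series /= (big_morph f fD f0).
  apply: normed_cvg; apply: series_le_cvg cv => // n /=; first exact: normr_ge0.
  exact: le_trans (fle _) (uv n).
have ReIm z : `|complex.Re z| <= Normc.normc z.
  by rewrite -lecR -norm_normc normc_ge_Re.
apply: cvg_ReIm; apply: dom => //; try by move=> [? ?] [? ?].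
by move=> [a b] /=; rewrite -[X in X <= _]sqrtr_sqr ler_wsqrtr // lerDr sqr_ge0.
Qed.

Lemma norm_le_cvg0 (R : realType) (u : nat -> R[i]) (v : nat -> R) :
  (forall n, Normc.normc (u n) <= v n) -> v @ \oo --> 0 -> u @ \oo --> (0 : R[i]).
Proof.
move=> uv /cvg_real_complex /cvgrPdist_lt v0; apply/cvgr0Pnorm_lt => e e0.
apply: filterS (v0 e e0) => n; apply: le_lt_trans.
have vn0 : 0 <= v n by rewrite (le_trans _ (uv n)) // -ler0c -norm_normc.
by rewrite rmorph0 sub0r normrN [leRHS]ger0_norm ?ler0c // norm_normc lecR.
Qed.

(** * The complex exponential and q-powers of scalar matrices *)

(** Passing from [n] to [n.+1] enlarges the triangle i + j < n by the antidiagonal i + j = n, whose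
    terms add up to (a + b)^n / n! by the binomial theorem. *)
Lemma series_exp_antidiagonals (K : numFieldType) (a b : K) n :
  \sum_(0 <= i < n) \sum_(0 <= j < n - i) (a ^+ i / i`!%:R) * (b ^+ j / j`!%:R) =
  \sum_(0 <= k < n) (a + b) ^+ k / k`!%:R.
Proof.
elim: n => [|n IH]; first by rewrite !big_geq.
rewrite big_nat_recr //= subSnn big_nat1 [RHS]big_nat_recr //= -IH.
have -> : \sum_(0 <= i < n) \sum_(0 <= j < n.+1 - i)
      (a ^+ i / i`!%:R) * (b ^+ j / j`!%:R) =
    \sum_(0 <= i < n) \sum_(0 <= j < n - i)
      (a ^+ i / i`!%:R) * (b ^+ j / j`!%:R) +
    \sum_(0 <= i < n) (a ^+ i / i`!%:R) * (b ^+ (n - i) / (n - i)`!%:R).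
  rewrite -big_split /=; apply: eq_big_nat => i /andP[_ lt_in].
  by rewrite subSn ?(ltnW lt_in) // big_nat_recr.
rewrite -addrA; congr (_ + _).
rewrite [a + b]addrC exprDn mulr_suml big_mkord.
rewrite -(big_mkord xpredT (fun i => b ^+ (n - i) * a ^+ i *+ 'C(n, i) / n`!%:R)).
rewrite big_nat_recr //= big_mkord; congr (_ + _); last first.
  by rewrite subnn binn !mulr1n divr1 mulr1 mul1r.
apply: eq_bigr => i _; have le_in : (i <= n)%N by exact: ltnW.
have factU k : (k`!%:R : K) != 0 by rewrite pnatr_eq0 -lt0n fact_gt0.
rewrite -(bin_fact le_in) !natrM -mulr_natr.
by field; rewrite !factU pnatr_eq0 -lt0n bin_gt0.
Qed.

(** The square of indices i, j < n splits into the triangle i + j < n and the remainder i + j >= n.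
    The field is left general because [cexpD] uses the identity over both [R] and [R[i]]. *)
Lemma series_exp_mul (K : numFieldType) (a b : K) n :
  (\sum_(0 <= i < n) a ^+ i / i`!%:R) * (\sum_(0 <= j < n) b ^+ j / j`!%:R) =
  \sum_(0 <= k < n) (a + b) ^+ k / k`!%:R +
  \sum_(0 <= i < n) \sum_(n - i <= j < n) (a ^+ i / i`!%:R) * (b ^+ j / j`!%:R).
Proof.
rewrite -series_exp_antidiagonals -big_split mulr_suml /=.
apply: eq_bigr => i _; rewrite mulr_sumr.
by rewrite (@big_cat_nat _ _ _ (n - i)) //= leq_subr.
Qed.

Lemma normc_nat (R : realType) k : Normc.normc (k%:R : R[i]) = k%:R.
Proof. by apply: complexI; rewrite -norm_normc rmorph_nat normr_nat. Qed.

Lemma normcX (R : realType) (z : R[i]) k :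
  Normc.normc (z ^+ k) = Normc.normc z ^+ k.
Proof. by apply: complexI; rewrite rmorphXn /= -!norm_normc normrX. Qed.

Lemma normc_exp_term (R : realType) (z : R[i]) k :
  Normc.normc (z ^+ k / k`!%:R) = exp_coeff (Normc.normc z) k.
Proof. by rewrite Normc.normcM Normc.normcV normc_nat normcX. Qed.

Lemma cexp_cvg (R : realType) (z : R[i]) :
  series (fun k => z ^+ k / k`!%:R) @ \oo --> cexp z.
Proof.
apply: (@norm_series_cvg _ _ (exp_coeff (Normc.normc z))).
  by move=> n; rewrite normc_exp_term.
exact: is_cvg_series_exp_coeff.
Qed.

Lemma cexpD (R : realType) (a b : R[i]) : cexp (a + b) = cexp a * cexp b.
Proof.
pose D (K : numFieldType) (x y : K) n := \sum_(0 <= i < n)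
  \sum_(n - i <= j < n) (x ^+ i / i`!%:R) * (y ^+ j / j`!%:R).
have D0 : D _ a b @ \oo --> (0 : R[i]).
  pose x := Normc.normc a; pose y := Normc.normc b.
  apply: (@norm_le_cvg0 _ _ (D _ x y)) => [n|].
    rewrite -lecR -norm_normc rmorph_sum /=; apply: le_trans (ler_norm_sum _ _ _) _.
    apply: ler_sum => i _; rewrite rmorph_sum /=.
    apply: le_trans (ler_norm_sum _ _ _) _; apply: ler_sum => j _.
    by rewrite norm_normc Normc.normcM !normc_exp_term.
  (* At real arguments the remainder is the product of the two partial sums minus the partial sum at
     [x + y], which tends to 0 by [expRD]. *)
  have -> : D _ x y = (series (exp_coeff x) \* series (exp_coeff y)) -
      series (exp_coeff (x + y)).
    apply/funext => n; apply/eqP; rewrite eq_sym subr_eq addrC; apply/eqP.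
    exact: series_exp_mul.
  rewrite -(subrr (expR (x + y))) {1}expRD.
  by apply: cvgB; first apply: cvgM; exact: is_cvg_series_exp_coeff.
have H := cvgB (K := R[i]) (cvgM (K := R[i]) (@cexp_cvg _ a) (@cexp_cvg _ b)) D0.
rewrite subr0 in H; rewrite -(cvg_lim (@norm_hausdorff _ _) (H _ _)).
rewrite /cexp; congr (limn _); apply/funext => n.
by apply/eqP; rewrite eq_sym subr_eq; apply/eqP; exact: series_exp_mul.
Qed.

Lemma cexp0 (R : realType) : cexp (0 : R[i]) = 1.
Proof.
apply: cvg_lim; first exact: norm_hausdorff.
(* Past the empty one, all partial sums equal 1. *)
rewrite -(cvg_shiftS _) /=; apply: cvg_near_cst; apply: nearW => n.
rewrite /series /= big_nat_recl //= expr0 fact0 invr1 mulr1 big1 ?addr0 // => i _.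
by rewrite exprS !mul0r.
Qed.

Lemma cexpMn (R : realType) (z : R[i]) n : cexp (n%:R * z) = cexp z ^+ n.
Proof.
elim: n => [|n IH]; first by rewrite mul0r cexp0.
by rewrite -natr1 mulrDl mul1r cexpD IH exprSr.
Qed.

Lemma cexpN (R : realType) (z : R[i]) : cexp (- z) = (cexp z)^-1.
Proof.
have e1 : cexp (- z) * cexp z = 1 by rewrite -cexpD addNr cexp0.
have ez : cexp z != 0.
  by apply/eqP => e0; move/eqP: e1; rewrite e0 mulr0 eq_sym oner_eq0.
by rewrite -[LHS]mulr1 -(divff ez) mulrA e1 mul1r.
Qed.

Lemma mexp_scalar (R : realType) (N : nat) (c : R[i]) :
  mexp (c%:M : 'M[R[i]]_N) = (cexp c)%:M.
Proof.
apply: cvg_lim; first exact: norm_hausdorff.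
have -> : series (fun k => (k`!%:R : R[i])^-1 *: (c%:M : 'M[R[i]]_N) ^+ k) =
    (fun n => series (fun k => c ^+ k / k`!%:R) n *: 1%:M).
  apply/funext => n; rewrite /series /= scaler_suml; apply: eq_bigr => k _.
  by rewrite -(rmorphXn (@scalar_mx _ N)) /= !scale_scalar_mx mulr1 mulrC.
have H := cvgZr_tmp (a := 1%:M : 'M[R[i]]_N) (@cexp_cvg _ c).
by rewrite scalemx1 in H; exact: H.
Qed.

Lemma qpow_scalar (R : realType) (N : nat) (logq c : R[i]) :
  qpow logq (c%:M : 'M[R[i]]_N) = (cexp (c * logq))%:M.
Proof. by rewrite /qpow scale_scalar_mx mexp_scalar mulrC. Qed.

Lemma mqpoch_scalar (R : realType) (N : nat) (q a : R[i]) k :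
  mqpoch q (a%:M : 'M[R[i]]_N) k = (qpoch q a k)%:M.
Proof.
rewrite /mqpoch /qpoch (rmorph_prod (@scalar_mx _ N)) /=.
by apply: eq_bigr => t _; rewrite scale_scalar_mx -raddfB.
Qed.

(** * Convergence and non-vanishing of the infinite q-product *)

(** A common criterion for the products (q;q)_k and for their reciprocals. The sequence is bounded,
    and its increments a_n u_n are then dominated by a geometric series. *)
Lemma cvgn_perturbed_recurrence (R : realType) (u a : nat -> R[i]) (C rho : R) :
  0 <= C -> 0 <= rho < 1 -> (forall n, u n.+1 = (1 + a n) * u n) ->
  (forall n, Normc.normc (a n) <= C * rho ^+ n) -> cvgn u.
Proof.
move=> C0 /andP[rho0 rho1] uS ale.
have g0 n : 0 <= geometric C rho n by rewrite /= mulr_ge0 // exprn_ge0.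
have cg : cvgn (series (geometric C rho)).
  by apply: is_cvg_geometric_series; rewrite ger0_norm.
(* By 1 + x <= e^x, the product of the 1 + C rho^k is at most the exponential of the geometric
   sum. *)
pose M := Normc.normc (u 0%N) * expR (limn (series (geometric C rho))).
have nc0 (z : R[i]) : 0 <= Normc.normc z by rewrite -ler0c -norm_normc.
have uM n : Normc.normc (u n) <= M.
  apply: (@le_trans _ _ (Normc.normc (u 0%N) * expR (series (geometric C rho) n))).
    elim: n => [|n IH]; first by rewrite /series /= big_geq // expR0 mulr1.
    rewrite uS Normc.normcM /series /= big_nat_recr //= expRD mulrA mulrC.
    apply: ler_pM => //.
    apply: (@le_trans _ _ (1 + C * rho ^+ n)); last exact: expR_ge1Dx.
    apply: (le_trans (le_normcD _ _)); rewrite Normc.normc1 lerD2l.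
    exact: ale.
  apply: ler_wpM2l => //; rewrite ler_expR.
  apply: nondecreasing_cvgn_le => //.
  by apply: nondecreasing_series => k _ _; exact: g0.
have uE : u = (fun=> u 0%N) + series (telescope u).
  by apply/funext => n; exact: eq_sum_telescope.
rewrite uE; apply: is_cvgD; first exact: is_cvg_cst.
apply: (@norm_series_cvg _ _ (geometric (M * C) rho)) => [n|].
  rewrite /telescope /= uS mulrDl mul1r addrAC subrr add0r Normc.normcM mulrC.
  by rewrite -mulrA ler_pM.
by apply: is_cvg_geometric_series; rewrite ger0_norm.
Qed.

Section QPochhammer.
Context {R : realType}.
Variable q : R[i].
Hypothesis q1 : `|q| < 1.

Lemma qpochS a k : qpoch q a k.+1 = qpoch q a k * (1 - q ^+ k * a).
Proof. by rewrite /qpoch big_ord_recr. Qed.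

Lemma qpoch_split a j k :
  qpoch q a (j + k) = qpoch q a j * qpoch q (q ^+ j * a) k.
Proof.
elim: k => [|k IH]; first by rewrite addn0 /qpoch big_ord0 mulr1.
by rewrite addnS !qpochS IH exprD; ring.
Qed.

Lemma normc_lt1 : Normc.normc q < 1.
Proof. by rewrite -ltcR -norm_normc. Qed.

(** This bound is uniform in [k]: it shows that no factor vanishes and supplies the constant for the
    reciprocals in [is_cvg_qpochV]. *)
Lemma normc_1subX k : 1 - Normc.normc q <= Normc.normc (1 - q ^+ k * q).
Proof.
rewrite -lecR rmorphB /= -!norm_normc -exprSr.
apply: le_trans (lerB_dist _ _); rewrite normr1 lerD2l lerN2 normrX.
by rewrite exprS ler_piMr // exprn_ile1 // ltW.
Qed.

Lemma qfactor_neq0 k : 1 - q ^+ k * q != 0.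
Proof.
apply/eqP => e0; have := normc_1subX k.
by rewrite e0 Normc.normc0 subr_le0 leNgt normc_lt1.
Qed.

Lemma qpoch_neq0 k : qpoch q q k != 0.
Proof. by apply/prodf_neq0 => t _; exact: qfactor_neq0. Qed.

Lemma qpoch_cvg : qpoch q q @ \oo --> qpoch_inf q q.
Proof.
have n0 : 0 <= Normc.normc q by rewrite -ler0c -norm_normc.
apply: (@cvgn_perturbed_recurrence _ _ (fun k => - (q ^+ k * q)) 1 (Normc.normc q)).
- exact: ler01.
- by rewrite n0 normc_lt1.
- by move=> k; rewrite qpochS mulrC.
move=> k; rewrite normcN Normc.normcM normcX mul1r.
by rewrite ler_piMr ?exprn_ge0 // ltW // normc_lt1.
Qed.

(** With x = q^(k+1), the recurrence comes from 1 / (1 - x) = 1 + x / (1 - x). Convergence of the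
    reciprocals is what keeps (q;q)_oo away from 0. *)
Lemma is_cvg_qpochV : cvgn (fun k => (qpoch q q k)^-1).
Proof.
have n0 : 0 <= Normc.normc q by rewrite -ler0c -norm_normc.
have d0 : 0 < 1 - Normc.normc q by rewrite subr_gt0 normc_lt1.
apply: (@cvgn_perturbed_recurrence _ _
  (fun k => (q ^+ k * q) / (1 - q ^+ k * q)) (1 - Normc.normc q)^-1 (Normc.normc q)).
- by rewrite invr_ge0 ltW.
- by rewrite n0 normc_lt1.
- move=> k; rewrite qpochS; field.
  by rewrite qpoch_neq0 qfactor_neq0.
move=> k; rewrite 2!Normc.normcM Normc.normcV normcX mulrC.
rewrite ler_pM ?invr_ge0 ?mulr_ge0 ?exprn_ge0 //.
- by rewrite (le_trans (ltW d0)) // normc_1subX.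
- by rewrite lef_pV2 ?posrE ?normc_1subX // (lt_le_trans d0) // normc_1subX.
- by rewrite ler_piMr ?exprn_ge0 // ltW // normc_lt1.
Qed.

Lemma qpoch_inf_neq0 : qpoch_inf q q != 0.
Proof.
have H := cvgM (K := R[i]) qpoch_cvg is_cvg_qpochV.
have E : (qpoch q q \* (fun k => (qpoch q q k)^-1)) = fun=> 1.
  by apply/funext => k; rewrite /= divff // qpoch_neq0.
have /eqP : qpoch_inf q q * limn (fun k => (qpoch q q k)^-1) = 1.
  apply/esym; rewrite -[LHS](lim_cst (F := \oo) (@norm_hausdorff _ R[i])) -E.
  by apply: cvg_lim; [exact: norm_hausdorff|exact: H].
by apply: contraTneq => ->; rewrite mul0r eq_sym oner_eq0.
Qed.

Lemma qpochV_cvg : (fun k => (qpoch q q k)^-1) @ \oo --> (qpoch_inf q q)^-1.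
Proof. by apply: (cvgV (K := R[i]) qpoch_inf_neq0); exact: qpoch_cvg. Qed.

Lemma qpoch_inf_split j :
  qpoch_inf q q = qpoch q q j * qpoch_inf q (q ^+ j.+1).
Proof.
have q0 := qpoch_neq0 j.
apply: (mulfI (invr_neq0 q0)); rewrite mulrA mulVf // mul1r; apply/esym.
apply: cvg_lim; first exact: norm_hausdorff.
have -> : qpoch q (q ^+ j.+1) = (fun k => (qpoch q q j)^-1 * qpoch q q (k + j)).
  by apply/funext => k; rewrite addnC qpoch_split mulKf // -exprSr.
apply: (cvgM (K := R[i])); first exact: cvg_cst.
by have := qpoch_cvg; rewrite -(cvg_shiftn j).
Qed.

(** * Euler's series at the powers of q *)

Let T j := series (fun r => q ^+ (j.+1 * r) / qpoch q q r).

(** The sum telescopes because 1/(q;q)_n + q^(n+1)/(q;q)_(n+1) = 1/(q;q)_(n+1). *)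
Let T0 n : T 0 n.+1 = (qpoch q q n)^-1.
Proof.
rewrite /T /series /=; elim: n => [|n IH].
  by rewrite big_nat1 muln0 expr0 div1r.
rewrite big_nat_recr //= IH mul1n qpochS exprSr; field.
by rewrite qpoch_neq0 qfactor_neq0.
Qed.

(** Write q^((j+2)r) = q^((j+1)r) - q^((j+1)r) (1 - q^r). Since (1 - q^r)/(q;q)_r = 1/(q;q)_(r-1)
    for r > 0, the second part is the same series shifted by one index, hence the factor q^(j+1) and
    one term fewer. *)
Let TS j n : T j.+1 n.+1 = T j n.+1 - q ^+ j.+1 * T j n.
Proof.
rewrite /T /series /=; elim: n => [|n IH].
  by rewrite !big_nat1 big_geq // mulr0 subr0 !muln0.
rewrite [LHS]big_nat_recr //= IH [X in _ = X - _]big_nat_recr //=.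
rewrite [X in _ = _ - _ * X]big_nat_recr //=.
have -> : (j.+2 * n.+1 = j.+1 * n + j.+1 + n.+1)%N by lia.
have -> : (j.+1 * n.+1 = j.+1 * n + j.+1)%N by lia.
set S1 := \sum_(0 <= _ < _) _; set S2 := \sum_(0 <= _ < _) _.
move: (j.+1 * n)%N => k; rewrite qpochS !exprD !exprS; field.
by rewrite qpoch_neq0 qfactor_neq0.
Qed.

(* The case z = q^(j+1) of Euler's expansion of 1/(z; q)_oo. *)
Lemma euler_series_cvg j :
  series (fun r => q ^+ (j.+1 * r) / qpoch q q r) @ \oo -->
    qpoch q q j / qpoch_inf q q.
Proof.
rewrite -/(T j); elim: j => [|j IH]; rewrite -cvg_shiftS.
  rewrite /qpoch big_ord0 div1r; under eq_fun do rewrite T0.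
  exact: qpochV_cvg.
under eq_fun do rewrite TS.
have -> : qpoch q q j.+1 / qpoch_inf q q =
    qpoch q q j / qpoch_inf q q - q ^+ j.+1 * (qpoch q q j / qpoch_inf q q).
  by rewrite qpochS exprSr; ring.
have H1 : (fun n => T j n.+1) @ \oo --> qpoch q q j / qpoch_inf q q.
  by rewrite (cvg_shiftS (T j)).
have H2 := cvgM (K := R[i]) (cvg_cst (q ^+ j.+1)) IH.
exact: (cvgB (K := R[i]) H1 (H2 _ _)).
Qed.

End QPochhammer.

(** * Terminating matrix series and the q-Laplace transform *)

Lemma limn_mxseries_finite (R : realType) (N n : nat) (f : nat -> 'M[R[i]]_N) :
  (forall k, (n < k)%N -> f k = 0) ->
  limn (series f) = \sum_(0 <= k < n.+1) f k.
Proof.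
move=> f0; apply: cvg_lim; first exact: norm_hausdorff.
rewrite -(cvg_shiftn n.+1); apply: cvg_near_cst; apply: nearW => k.
rewrite /series /= (@big_cat_nat _ _ _ n.+1) ?leq_addl //=.
rewrite [X in _ + X]big_nat [X in _ + X]big1 ?addr0 // => i /andP[ni _].
exact: f0.
Qed.

Lemma qpow_natr (R : realType) (N : nat) (q logq : R[i]) (n : nat) :
  cexp logq = q -> qpow logq ((n%:R)%:M : 'M[R[i]]_N) = (q ^+ n)%:M.
Proof. by move=> e; rewrite qpow_scalar cexpMn e. Qed.

Lemma qpow_natrN (R : realType) (N : nat) (q logq : R[i]) (n : nat) :
  cexp logq = q -> qpow logq ((- n%:R)%:M : 'M[R[i]]_N) = ((q ^+ n)^-1)%:M.
Proof. by move=> e; rewrite qpow_scalar mulNr cexpN cexpMn e. Qed.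

(** The factor of index [n] is 1 - q^n q^(-n) = 0. *)
Lemma qpoch_negpow_eq0 (R : realType) (q : R[i]) n k :
  q != 0 -> (n < k)%N -> qpoch q (q ^+ n)^-1 k = 0.
Proof.
move=> q0 nk; rewrite /qpoch (bigD1 (Ordinal nk)) //= divff ?expf_neq0 //.
by rewrite subrr mul0r.
Qed.

(** Both formulas of the theorem at once, with [m] standing for the exponent of t: [m = 0] gives the
    first, and [m - 1] in place of [m] the second. *)
Lemma qLaplace_powM_qBessel (R : realType) (q logq : R[i])
    (hq : 0 < `|q| < 1) (hlogq : cexp logq = q)
    (n m N : nat) (A : 'M[R[i]]_N) (s : R[i]) (hs : s != 0) :
  cvgn (qLaplace_series s q (fun t => t ^+ m *: qBessel q logq n t A)) /\
  qLaplace s q (fun t => t ^+ m *: qBessel q logq n t A) =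
     (qpoch_inf q q / (s ^+ m.+1 * qpoch q q n * qpoch_inf q (q ^+ m.+1))) *:
       mqpoch q (qpow logq (A - 1%:M)) n *m
     phi32_00 (qpow logq (- n%:R)%:M) (qpow logq (A + (n%:R - 1)%:M))
       (q ^+ m.+1)%:M q (1 / s).
Proof.
have /andP[q_gt0 q1] := hq; have q0 : q != 0 by rewrite -normr_gt0.
set C := mqpoch q (qpow logq (A - 1%:M)) n.
pose B k := mqpoch q (qpow logq (- n%:R)%:M : 'M[R[i]]_N) k *m
  mqpoch q (qpow logq (A + (n%:R - 1)%:M)) k.
have B0 k : (n < k)%N -> B k = 0.
  move=> nk; rewrite /B (qpow_natrN _ _ hlogq) mqpoch_scalar qpoch_negpow_eq0 //.
  by rewrite mul_scalar_mx scale0r.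
have BE z : limn (series (fun k => (z ^+ k / qpoch q q k) *: B k)) =
    \sum_(0 <= k < n.+1) (z ^+ k / qpoch q q k) *: B k.
  by apply: limn_mxseries_finite => k nk; rewrite B0 // scaler0.
have qn0 k : qpoch q q k != 0 by exact: qpoch_neq0.
have qinf0 := qpoch_inf_neq0 q1.
(* [c k] gathers the scalars independent of the summation index r, and [L p] is the limit given by
   [euler_series_cvg]. *)
pose c k : R[i] := (s ^+ (m + k) * qpoch q q n * qpoch q q k)^-1.
pose L (p : nat) : R[i] := qpoch q q p / qpoch_inf q q.
have seriesE : qLaplace_series s q (fun t => t ^+ m *: qBessel q logq n t A) =
    (fun M => \sum_(0 <= k < n.+1)
       series (fun r => q ^+ ((m + k).+1 * r) / qpoch q q r) M *: (c k *: (C *m B k))).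
  apply/funext => M; rewrite /qLaplace_series /series /=.
  under [RHS]eq_bigr do rewrite scaler_suml.
  rewrite exchange_big /=; apply: eq_bigr => r _.
  rewrite /qBessel BE -/C -scalemxAl mulmx_sumr !scaler_sumr.
  apply: eq_bigr => k _.
  rewrite -scalemxAr !scalerA; congr (_ *: _).
  (* The exponent comes from q^r (q^r/s)^(m+k) = q^((m+k+1)r) / s^(m+k). *)
  rewrite /c mulSn exprD mulnC exprM !expr_div_n !exprD; field.
  by rewrite !qn0 !expf_neq0.
have cvgL : qLaplace_series s q (fun t => t ^+ m *: qBessel q logq n t A) @ \oo -->
    \sum_(0 <= k < n.+1) L (m + k)%N *: (c k *: (C *m B k)).
  rewrite seriesE; apply: cvg_big => [|k _]; first exact: add_continuous.
  by apply: cvgZr_tmp; exact: euler_series_cvg.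
split; first by apply/cvg_ex; eexists; exact: cvgL.
rewrite /qLaplace (cvg_lim (@norm_hausdorff _ _) cvgL).
have phiE : phi32_00 (qpow logq (- n%:R)%:M) (qpow logq (A + (n%:R - 1)%:M))
    (q ^+ m.+1)%:M q (1 / s) = \sum_(0 <= k < n.+1)
      ((1 / s) ^+ k / qpoch q q k * qpoch q (q ^+ m.+1) k) *: B k.
  rewrite /phi32_00 (@limn_mxseries_finite _ _ n) => [|k nk].
    apply: eq_bigr => k _.
    by rewrite mqpoch_scalar mul_mx_scalar scalerA.
  by rewrite -/(B k) B0 // mul0mx scaler0.
rewrite phiE -scalemxAl mulmx_sumr !scaler_sumr; apply: eq_bigr => k _.
rewrite -!scalemxAr !scalerA; congr (_ *: _).
(* Comparing coefficients uses (q;q)_oo = (q;q)_m (q^(m+1);q)_oo and (q;q)_(m+k) = (q;q)_m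
   (q^(m+1);q)_k. *)
have infm := qpoch_inf_split q1 m.
have qm0 : qpoch_inf q (q ^+ m.+1) != 0.
  by apply: contraNneq qinf0 => z; rewrite infm z mulr0.
have mk := qpoch_split q q m k; rewrite -exprSr in mk.
rewrite /L mk /c infm expr_div_n expr1n exprD (exprS s). field.
by rewrite qm0 !qn0 expf_neq0 // hs expf_neq0.
Qed.

Theorem theorem2p6 (R : realType) (q logq : R[i])
    (hq : 0 < `|q| < 1) (hlogq : cexp logq = q)
    (n m : nat) (hn : (0 < n)%N) (hm : (0 < m)%N)
    (N : nat) (hN : (0 < N)%N) (A : 'M[R[i]]_N) (hA : positive_stable A)
    (s : R[i]) (hs : s != 0) :
  (cvgn (qLaplace_series s q (fun t => qBessel q logq n t A)) /\
   qLaplace s q (fun t => qBessel q logq n t A) =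
     (s * qpoch q q n)^-1 *: mqpoch q (qpow logq (A - 1%:M)) n *m
     phi32_00 (qpow logq (- n%:R)%:M) (qpow logq (A + (n%:R - 1)%:M)) q%:M
       q (1 / s)) /\
  (cvgn (qLaplace_series s q
           (fun t => t ^+ (m - 1) *: qBessel q logq n t A)) /\
   qLaplace s q (fun t => t ^+ (m - 1) *: qBessel q logq n t A) =
     (qpoch_inf q q / (s ^+ m * qpoch q q n * qpoch_inf q (q ^+ m))) *:
       mqpoch q (qpow logq (A - 1%:M)) n *m
     phi32_00 (qpow logq (- n%:R)%:M) (qpow logq (A + (n%:R - 1)%:M))
       (qpow logq (m%:R)%:M) q (1 / s)).
Proof.
split; last first.
  case: m hm => // m _; rewrite subn1 /= (qpow_natr _ _ hlogq).
  exact: qLaplace_powM_qBessel.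
have /andP[_ q1] := hq.
have := qLaplace_powM_qBessel hq hlogq n 0 A hs.
have -> : (fun t => t ^+ 0 *: qBessel q logq n t A) =
    (fun t => qBessel q logq n t A).
  by apply/funext => t; rewrite expr0 scale1r.
rewrite !expr1.
(* For exponent 0 the infinite product in the denominator is (q;q)_oo itself, which is nonzero and
   cancels. *)
suff -> : qpoch_inf q q / (s * qpoch q q n * qpoch_inf q q) = (s * qpoch q q n)^-1 by [].
by rewrite invfM mulrCA divff ?mulr1 // qpoch_inf_neq0.
Qed.
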